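(* Let $N, M, Y \ge 1$, let $k \in \{1,\dots,M\}$, and let $(x_i,y_i)_{i=1}^N$ be a multi-modal dataset with $x_i = (m_i^1,\dots,m_i^M)$ and labels $y_i \in \mathbb{R}^Y$. Let $\phi_j(\vartheta_j;\cdot)$, $j=1,\dots,M$, be modality learners with values in $\mathbb{R}^Y$, let $\Phi_{M/k}(x_i) = \sum_{j\ne k}\phi_j(\vartheta_j;m_i^j)$ with the parameters $\vartheta_j$, $j\neq k$, held fixed, let $\ell:\mathbb{R}^Y\times\mathbb{R}^Y\to\mathbb{R}$ be a loss differentiable in its first argument, let $\mathbb{D}_s:\mathbb{R}^Y\times\mathbb{R}^Y\to\mathbb{R}$ be differentiable in its second argument, and let $\lambda\in\mathbb{R}$. Assume $\vartheta_k\mapsto\phi_k(\vartheta_k;m_i^k)$ is differentiable for each $i$. Suppose that for every $i\in\{1,\dots,N\}$ $$\lambda\,\nabla_{\phi_k}\mathbb{D}_s\big(\Phi_{M/k}(x_i),\phi_k(\vartheta_k;m_i^k)\big) = \nabla_{\phi_k}\ell\big(\phi_k(\vartheta_k;m_i^k),y_i\big) - \nabla_{\phi_k}\ell\big(\phi_k(\vartheta_k;m_i^k),\,-\nabla_{\Phi_{M/k}}\ell(\Phi_{M/k}(x_i),y_i)\big).$$ Then the two optimization objectives have the same gradient with respect to $\vartheta_k$: $$\nabla_{\vartheta_k}\tilde{\mathcal{L}}_s\big(\phi_k(m^k),y\big) = \nabla_{\vartheta_k}\mathcal{L}\big(\phi_k(m^k),\,-\nabla_{\Phi_{M/k}}\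ell(\Phi_{M/k}(x),y)\big).$$
   Context: Each example $i$ has raw features $x_i=(m_i^1,\dots,m_i^M)$ from $M$ modalities and a label vector $y_i\in\mathbb{R}^Y$ (one-hot in applications). The $k$-th modality learner is a parametrized map $\phi_k(\vartheta_k;m_i^k)\in\mathbb{R}^Y$ with parameter vector $\vartheta_k$ in a Euclidean space. For a function evaluated at $\phi_k(\vartheta_k;m_i^k)$, $\nabla_{\phi_k}$ denotes the gradient with respect to the argument in which $\phi_k(\vartheta_k;m_i^k)\in\mathbb{R}^Y$ is inserted (for $\ell$ the first argument, for $\mathbb{D}_s$ the second), evaluated at that point. Likewise $\nabla_{\Phi_{M/k}}\ell(\Phi_{M/k}(x_i),y_i)\in\mathbb{R}^Y$ is the gradient of $\ell(\cdot,y_i)$ at $\Phi_{M/k}(x_i)$; it does not depend on $\vartheta_k$. For any target vectors $q=(q_i)_{i=1}^N$, $q_i\in\mathbb{R}^Y$, put $$\mathcal{L}(\phi_k(m^k),q)=\frac1N\sum_{i=1}^N \ell\big(\phi_k(\vartheta_k;m_i^k),q_i\big).$$ In particular $\mathcal{L}\big(\phi_k(m^k),-\nabla_{\Phi_{M/k}}\ell(\Phi_{M/k}(x),y)\big)$ uses the targets (pseudo-labels) $q_i=-\nabla_{\Phi_{M/k}}\ell(\Phi_{M/k}(x_i),y_i)$. The regularized objective is $$\tilde{\mathcal{L}}_s(\phi_k(m^k),y)=\frac1N\sum_{i=1}^N\Big[\ell\big(\phi_k(\vartheta_k;m_i^k),y_i\big)-\lambda\,\mathbb{D}_s\big(\Phi_{M/k}(x_i),\phi_k(\vartheta_k;m_i^k)\big)\Big],$$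 where $\mathbb{D}_s$ is called the reconcilement regularization. *)

(* Defs.v *)
From HB Require Import structures.
From mathcomp Require Import all_boot all_order all_algebra.
From mathcomp Require Import all_classical all_reals all_analysis.

Set Implicit Arguments.
Unset Strict Implicit.
Unset Printing Implicit Defensive.

Import Order.TTheory GRing.Theory Num.Theory.
Import numFieldNormedType.Exports.

Local Open Scope ring_scope.

(* Gradient with respect to the standard inner product: the row vector of
   partial derivatives. The norm that the library puts on ['rV[R]_n] is the
   sup norm; it is equivalent to the Euclidean one, so [differentiable] has
   its usual meaning. *)
Definition grad (R : realType) (n : nat) (f : 'rV[R]_n -> R) (u : 'rV[R]_n) :
    'rV[R]_n :=
  \row_(j < n) 'D_(delta_mx 0 j) f u.

(* $\Phi_{M/k}$: the sum of all learners but the k-th; [xi j] is the feature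
   of the example in modality [j], [X j] being the feature space of that
   modality and [p j] the number of parameters of the j-th learner. *)
Definition ensemble_without (R : realType) (M Y : nat)
    (X : 'I_M -> Type) (p : 'I_M -> nat)
    (phi : forall j : 'I_M, 'rV[R]_(p j) -> X j -> 'rV[R]_Y)
    (theta : forall j : 'I_M, 'rV[R]_(p j)) (k : 'I_M)
    (xi : forall j : 'I_M, X j) : 'rV[R]_Y :=
  \sum_(j < M | j != k) phi j (theta j) (xi j).

(* $\mathcal{L}(\phi_k(m^k), q)$, where [f] is [phi k (theta k)] and [m i] is
   $m_i^k$. *)
Definition risk (R : realType) (N Y : nat) (T : Type)
    (ell : 'rV[R]_Y -> 'rV[R]_Y -> R)
    (f : T -> 'rV[R]_Y) (m : 'I_N -> T) (q : 'I_N -> 'rV[R]_Y) : R :=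
  N%:R^-1 * \sum_(i < N) ell (f (m i)) (q i).

(* $\tilde{\mathcal{L}}_s(\phi_k(m^k), y)$, where [Phi i] is
   $\Phi_{M/k}(x_i)$. *)
Definition regularized_risk (R : realType) (N Y : nat) (T : Type)
    (ell Ds : 'rV[R]_Y -> 'rV[R]_Y -> R) (lambda : R)
    (Phi : 'I_N -> 'rV[R]_Y)
    (f : T -> 'rV[R]_Y) (m : 'I_N -> T) (y : 'I_N -> 'rV[R]_Y) : R :=
  N%:R^-1 *
  \sum_(i < N) (ell (f (m i)) (y i) - lambda * Ds (Phi i) (f (m i))).

(* $-\nabla_{\Phi_{M/k}} \ell(\Phi_{M/k}(x_i), y_i)$ at [a = Phi_{M/k}(x_i)]. *)
Definition pseudo_label (R : realType) (Y : nat)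
    (ell : 'rV[R]_Y -> 'rV[R]_Y -> R) (a y : 'rV[R]_Y) : 'rV[R]_Y :=
  - grad (fun v => ell v y) a.

(* Main.v *)
Require Import Defs.
From HB Require Import structures.
From mathcomp Require Import all_boot all_order all_algebra.
From mathcomp Require Import all_classical all_reals all_analysis.

Set Implicit Arguments.
Unset Strict Implicit.
Unset Printing Implicit Defensive.

Import Order.TTheory GRing.Theory Num.Theory.
Import numFieldNormedType.Exports.

Local Open Scope ring_scope.

(** By the chain rule, the derivative of a summand along a parameter direction pairs its gradient at
    the output of the k-th learner with the differential of that learner ([derive_comp_grad]).
    [Phi i] omits the k-th learner, so it and the pseudo-label [q i] are constants here. Both
    objectives thus carry the same differential for each example, and the hypothesis says exactly
    that the output gradients agree; averaging ([derive_mean]) concludes. *)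

Lemma diff_grad (R : realType) (n : nat) (g : 'rV[R]_n -> R) (u w : 'rV[R]_n) :
  differentiable g u -> 'd g u w = \sum_(j < n) w 0 j * grad g u 0 j.
Proof.
move=> dg; rewrite {1}(row_sum_delta w) linear_sum; apply: eq_bigr => j _.
by rewrite linearZ /= mxE deriveE.
Qed.

(** Chain rule in coordinates: the factor ['d f t v] does not involve [g], so it can be factored out
    when several outer functions share one learner. *)
Lemma derive_comp_grad (R : realType) (m n : nat) (g : 'rV[R]_n -> R)
    (f : 'rV[R]_m -> 'rV[R]_n) (t v : 'rV[R]_m) :
  differentiable f t -> differentiable g (f t) ->
  'D_v (fun s => g (f s)) t =
  \sum_(j < n) ('d f t v) 0 j * grad g (f t) 0 j.
Proof.
move=> df dg; rewrite -diff_grad // deriveE; last exact: differentiable_comp.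
by rewrite (diff_comp df dg).
Qed.

Lemma derive_mean (R : realType) (V : normedModType R) (N : nat)
    (h : 'I_N -> V -> R) (t v : V) :
  (forall i, derivable (h i) t v) ->
  'D_v (fun s => N%:R^-1 * \sum_(i < N) h i s) t =
  N%:R^-1 * \sum_(i < N) 'D_v (h i) t.
Proof.
move=> dh.
(* The pointwise mean is recast as a scaled sum in the space of functions, the form to which the
   derivative rules apply. *)
have -> : (fun s => N%:R^-1 * \sum_(i < N) h i s) =
          N%:R^-1 \*: (\sum_(i < N) h i).
  by apply/funext => s /=; rewrite fct_sumE.
by rewrite deriveZ ?derive_sum //; exact: derivable_sum.
Qed.

Theorem theorem3p1 (R : realType) (N M Y : nat)
    (hN : (1 <= N)%N) (hM : (1 <= M)%N) (hY : (1 <= Y)%N)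
    (k : 'I_M)
    (X : 'I_M -> Type)
    (x : 'I_N -> forall j : 'I_M, X j) (y : 'I_N -> 'rV[R]_Y)
    (p : 'I_M -> nat)
    (phi : forall j : 'I_M, 'rV[R]_(p j) -> X j -> 'rV[R]_Y)
    (theta : forall j : 'I_M, 'rV[R]_(p j))
    (ell Ds : 'rV[R]_Y -> 'rV[R]_Y -> R) (lambda : R)
    (ell_diff : forall q u : 'rV[R]_Y, differentiable (fun v => ell v q) u)
    (Ds_diff : forall a u : 'rV[R]_Y, differentiable (fun v => Ds a v) u)
    (phi_diff : forall (i : 'I_N) (t : 'rV[R]_(p k)),
        differentiable (fun s => phi k s (x i k)) t)
    (Phi := fun i : 'I_N => ensemble_without phi theta k (x i))
    (q := fun i : 'I_N => pseudo_label ell (Phi i) (y i))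
    (reconcilement : forall i : 'I_N,
        lambda *: grad (fun v => Ds (Phi i) v) (phi k (theta k) (x i k)) =
        grad (fun v => ell v (y i)) (phi k (theta k) (x i k))
        - grad (fun v => ell v (q i)) (phi k (theta k) (x i k))) :
  grad (fun t => regularized_risk ell Ds lambda Phi
                   (phi k t) (fun i => x i k) y) (theta k) =
  grad (fun t => risk ell (phi k t) (fun i => x i k) q) (theta k).
Proof.
apply/rowP => j; rewrite !mxE /regularized_risk /risk.
have dcomp (g : 'rV[R]_Y -> R) i : (forall u, differentiable g u) ->
    derivable (fun t => g (phi k t (x i k))) (theta k) (delta_mx 0 j).
  by move=> dg; apply: diff_derivable; exact: differentiable_comp.
have dell a i := dcomp _ i (ell_diff a).
have dDs i := dcomp _ i (Ds_diff (Phi i)).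
have dlDs i : derivable (fun t => lambda * Ds (Phi i) (phi k t (x i k)))
    (theta k) (delta_mx 0 j) by exact: derivableZ.
rewrite !derive_mean; last 2 first.
- by move=> i; exact: dell.
- by move=> i; exact: derivableB.
congr (_ * _); apply: eq_bigr => i _.
(* Linearity separates the loss from the regularizer, so that the chain rule applies to each
   alone. *)
transitivity ('D_(delta_mx 0 j) (fun t => ell (phi k t (x i k)) (y i)) (theta k)
    - lambda *
      'D_(delta_mx 0 j) (fun t => Ds (Phi i) (phi k t (x i k))) (theta k)).
  rewrite [LHS](deriveB (dell _ _) (dlDs _)); congr (_ - _).
  exact: (deriveZ lambda (dDs i)).
rewrite (derive_comp_grad _ (phi_diff i _) (ell_diff (y i) _)).
rewrite (derive_comp_grad _ (phi_diff i _) (Ds_diff (Phi i) _)).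
rewrite (derive_comp_grad _ (phi_diff i _) (ell_diff (q i) _)).
rewrite mulr_sumr -sumrB; apply: eq_bigr => l _.
(* Cancelling the common Jacobian entry leaves coordinate [l] of the hypothesis, rearranged. *)
rewrite mulrCA -mulrBr; congr (_ * _).
have /rowP/(_ l) := reconcilement i.
(* The patterns open only the scaling, the sum and the opposite, keeping [grad] folded as in the
   goal. *)
rewrite [X in X = _ -> _]mxE [X in _ = X -> _]mxE.
by rewrite [X in _ = _ + X -> _]mxE => ->; rewrite subKr.
Qed.
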